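(* For all integers $p,q\ge 0$ there is an isomorphism of real algebras $$K_{p,q}\;\cong\;\underbrace{K_{1,0}\otimes K_{1,0}\otimes\cdots\otimes K_{1,0}}_{p\text{ times}}\;\otimes\;\underbrace{K_{0,1}\otimes K_{0,1}\otimes\cdots\otimes K_{0,1}}_{q\text{ times}}.$$
   Context: For integers $p,q\ge 0$ and $n:=p+q$, the commutative analogue of Clifford algebra $K_{p,q}$ is the real associative algebra with unity generated by $e_1,\dots,e_n$ subject to $e_i^2=1$ for $1\le i\le p$, $e_i^2=-1$ for $p+1\le i\le n$, and $e_ie_j=e_je_i$ for all $i,j\in\{1,\dots,n\}$. For $A=\{i_1<\cdots<i_l\}\subseteq\{1,\dots,n\}$ put $e_A:=e_{i_1}\cdots e_{i_l}$, with $e_{\{\}}:=1$; the elements $e_A$, $A\subseteq\{1,\dots,n\}$, form a basis of $K_{p,q}$ as a real vector space, so it has dimension $2^n$. Tensor products are over $\mathbb{R}$, with the multiplication $(a_1\otimes\cdots\otimes a_n)(b_1\otimes\cdots\otimes b_n)=(a_1b_1)\otimes\cdots\otimes(a_nb_n)$ extended bilinearly. An empty tensor product is $\mathbb{R}$. *)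

(* Defs.v *)
From HB Require Import structures.
From mathcomp Require Import all_boot all_order all_algebra generic_quotient.
From mathcomp Require Import boolp classical_sets reals.

Set Implicit Arguments.
Unset Strict Implicit.
Unset Printing Implicit Defensive.

Import GRing.Theory.
Local Open Scope ring_scope.
Local Open Scope quotient_scope.

(******************************************************************************)
(*  presented S == the associative unital R-algebra with generators indexed   *)
(*                 by I and relations S: formal expressions in the generators *)
(*                 modulo the least congruence containing S and the axioms of *)
(*                 associative unital R-algebras                              *)
(*        K R p q == the commutative analogue of Clifford algebra K_{p,q}     *)
(*       tensor A == the tensor product over R of a finite family of algebras *)
(*                   A i: formal linear combinations of pure tensors, modulo  *)
(*                   the least linear congruence that makes pure tensors      *)
(*                   multilinear, with the product determined by              *)
(*                   pure a * pure b = pure (fun i => a i * b i) (cf. pureM); *)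
(*                   for an empty index type it is the line spanned by 1      *)
(******************************************************************************)

Section PresentedAlgebra.
Variables (R : fieldType) (I : Type).

Inductive aterm : Type :=
  | AGen of I
  | AZero
  | AOne
  | AAdd of aterm & aterm
  | AMul of aterm & aterm
  | AScale of R & aterm.

HB.instance Definition _ := gen_eqMixin aterm.
HB.instance Definition _ := gen_choiceMixin aterm.

Inductive acongr (S : aterm -> aterm -> Prop) : aterm -> aterm -> Prop :=
  | acongr_rel s t : S s t -> acongr S s t
  | acongr_refl t : acongr S t t
  | acongr_sym s t : acongr S s t -> acongr S t s
  | acongr_trans s t u : acongr S s t -> acongr S t u -> acongr S s u
  | acongrD s s' t t' : acongr S s s' -> acongr S t t' ->
      acongr S (AAdd s t) (AAdd s' t')
  | acongrM s s' t t' : acongr S s s' -> acongr S t t' ->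
      acongr S (AMul s t) (AMul s' t')
  | acongrZ c t t' : acongr S t t' -> acongr S (AScale c t) (AScale c t')
  | acongr_addA s t u : acongr S (AAdd s (AAdd t u)) (AAdd (AAdd s t) u)
  | acongr_addC s t : acongr S (AAdd s t) (AAdd t s)
  | acongr_add0 t : acongr S (AAdd AZero t) t
  | acongr_addN t : acongr S (AAdd (AScale (- 1) t) t) AZero
  | acongr_mulA s t u : acongr S (AMul s (AMul t u)) (AMul (AMul s t) u)
  | acongr_mul1l t : acongr S (AMul AOne t) t
  | acongr_mul1r t : acongr S (AMul t AOne) t
  | acongr_mulDl s t u :
      acongr S (AMul (AAdd s t) u) (AAdd (AMul s u) (AMul t u))
  | acongr_mulDr s t u :
      acongr S (AMul s (AAdd t u)) (AAdd (AMul s t) (AMul s u))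
  | acongr_scaleA c d t :
      acongr S (AScale c (AScale d t)) (AScale (c * d) t)
  | acongr_scale1 t : acongr S (AScale 1 t) t
  | acongr_scaleDr c s t :
      acongr S (AScale c (AAdd s t)) (AAdd (AScale c s) (AScale c t))
  | acongr_scaleDl c d t :
      acongr S (AScale (c + d) t) (AAdd (AScale c t) (AScale d t))
  | acongr_scaleAl c s t :
      acongr S (AScale c (AMul s t)) (AMul (AScale c s) t)
  | acongr_scaleAr c s t :
      acongr S (AScale c (AMul s t)) (AMul s (AScale c t)).

Variable S : aterm -> aterm -> Prop.

Definition acongrb : rel aterm := fun s t => `[< acongr S s t >].

Lemma acongrb_refl : reflexive acongrb.
Proof. by move=> t; apply/asboolP; apply: acongr_refl. Qed.

Lemma acongrb_sym : symmetric acongrb.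
Proof. by move=> s t; apply/asboolP/asboolP => /acongr_sym. Qed.

Lemma acongrb_trans : transitive acongrb.
Proof.
move=> t s u /asboolP st /asboolP tu; apply/asboolP; exact: acongr_trans st tu.
Qed.

Canonical acongr_equiv := EquivRel acongrb acongrb_refl acongrb_sym acongrb_trans.

Definition presented := {eq_quot acongr_equiv}.

HB.instance Definition _ := EqQuotient.on presented.
HB.instance Definition _ := Choice.on presented.

Lemma presentedP s t : \pi_presented s = \pi_presented t <-> acongr S s t.
Proof. by split=> [/eqmodP/asboolP|st]; [|apply/eqmodP/asboolP]. Qed.

Lemma acongr_repr t : acongr S (repr (\pi_presented t)) t.
Proof. by apply/presentedP; rewrite reprK. Qed.

Definition pgen i : presented := \pi_presented (AGen i).
Definition pzero : presented := \pi_presented AZero.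
Definition pone : presented := \pi_presented AOne.
Definition padd (x y : presented) : presented := \pi_presented (AAdd (repr x) (repr y)).
Definition pmul (x y : presented) : presented := \pi_presented (AMul (repr x) (repr y)).
Definition pscale c (x : presented) : presented := \pi_presented (AScale c (repr x)).
Definition popp (x : presented) : presented := pscale (- 1) x.

Lemma pi_add s t : padd (\pi_presented s) (\pi_presented t) = \pi_presented (AAdd s t).
Proof. by apply/presentedP; apply: acongrD; apply: acongr_repr. Qed.

Lemma pi_mul s t : pmul (\pi_presented s) (\pi_presented t) = \pi_presented (AMul s t).
Proof. by apply/presentedP; apply: acongrM; apply: acongr_repr. Qed.

Lemma pi_scale c t : pscale c (\pi_presented t) = \pi_presented (AScale c t).
Proof. by apply/presentedP; apply: acongrZ; apply: acongr_repr. Qed.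

Definition pi_presentedE := (pi_add, pi_mul, pi_scale).
Lemma paddA : associative padd.
Proof.
by elim/quotW=> s; elim/quotW=> t; elim/quotW=> u;
  rewrite (pi_add t u) (pi_add s t) !pi_add; apply/presentedP; constructor.
Qed.

Lemma paddC : commutative padd.
Proof.
by elim/quotW=> s; elim/quotW=> t;
  rewrite !pi_add; apply/presentedP; constructor.
Qed.

Lemma padd0 : left_id pzero padd.
Proof.
by elim/quotW=> t; rewrite /pzero pi_add; apply/presentedP; constructor.
Qed.

Lemma paddN : left_inverse pzero popp padd.
Proof.
by elim/quotW=> t; rewrite /popp pi_scale pi_add; apply/presentedP; constructor.
Qed.

HB.instance Definition _ := GRing.isZmodule.Build presented paddA paddC padd0 paddN.

Lemma pmulA : associative pmul.
Proof.
by elim/quotW=> s; elim/quotW=> t; elim/quotW=> u;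
  rewrite (pi_mul t u) (pi_mul s t) !pi_mul; apply/presentedP; constructor.
Qed.

Lemma pmul1l : left_id pone pmul.
Proof.
by elim/quotW=> t; rewrite /pone pi_mul; apply/presentedP; constructor.
Qed.

Lemma pmul1r : right_id pone pmul.
Proof.
by elim/quotW=> t; rewrite /pone pi_mul; apply/presentedP; constructor.
Qed.

Lemma pmulDl : left_distributive pmul padd.
Proof.
by elim/quotW=> s; elim/quotW=> t; elim/quotW=> u;
  rewrite (pi_add s t) (pi_mul s u) (pi_mul t u) pi_add pi_mul; apply/presentedP; constructor.
Qed.

Lemma pmulDr : right_distributive pmul padd.
Proof.
by elim/quotW=> s; elim/quotW=> t; elim/quotW=> u;
  rewrite (pi_add t u) (pi_mul s t) (pi_mul s u) pi_add pi_mul; apply/presentedP; constructor.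
Qed.

HB.instance Definition _ :=
  GRing.Zmodule_isPzRing.Build presented pmulA pmul1l pmul1r pmulDl pmulDr.

Lemma pscaleA c d x : pscale c (pscale d x) = pscale (c * d) x.
Proof.
by elim/quotW: x => t; rewrite (pi_scale d t) !pi_scale; apply/presentedP; constructor.
Qed.

Lemma pscale1 : left_id 1 pscale.
Proof.
by elim/quotW=> t; rewrite pi_scale; apply/presentedP; constructor.
Qed.

Lemma pscaleDr : right_distributive pscale padd.
Proof.
by move=> c; elim/quotW=> s; elim/quotW=> t;
  rewrite (pi_add s t) (pi_scale c s) (pi_scale c t) pi_add pi_scale; apply/presentedP; constructor.
Qed.

Lemma pscaleDl x : {morph pscale^~ x : c d / c + d >-> padd c d}.
Proof.
by move=> c d; elim/quotW: x => t;
  rewrite !pi_scale pi_add; apply/presentedP; constructor.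
Qed.

HB.instance Definition _ :=
  GRing.Zmodule_isLmodule.Build R presented pscaleA pscale1 pscaleDr pscaleDl.

Lemma pscaleAl c (x y : presented) : c *: (x * y) = (c *: x) * y.
Proof.
elim/quotW: x => s; elim/quotW: y => t; rewrite /GRing.scale /GRing.mul /=.
by rewrite (pi_mul s t) (pi_scale c s) pi_mul pi_scale; apply/presentedP; constructor.
Qed.

Lemma pscaleAr c (x y : presented) : c *: (x * y) = x * (c *: y).
Proof.
elim/quotW: x => s; elim/quotW: y => t; rewrite /GRing.scale /GRing.mul /=.
by rewrite (pi_mul s t) (pi_scale c t) pi_mul pi_scale; apply/presentedP; constructor.
Qed.

Fixpoint aeval (B : algType R) (g : I -> B) (t : aterm) : B :=
  match t with
  | AGen i => g i
  | AZero => 0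
  | AOne => 1
  | AAdd s t => aeval g s + aeval g t
  | AMul s t => aeval g s * aeval g t
  | AScale c t => c *: aeval g t
  end.

Lemma acongr_aeval (B : algType R) (g : I -> B) :
  (forall s t, S s t -> aeval g s = aeval g t) ->
  forall s t, acongr S s t -> aeval g s = aeval g t.
Proof.
move=> gS s t; elim=> //=.
- by move=> ? ? ? _ -> _ ->.
- by move=> ? ? ? ? _ -> _ ->.
- by move=> ? ? ? ? _ -> _ ->.
- by move=> ? ? ? _ ->.
- by move=> *; rewrite addrA.
- by move=> *; rewrite addrC.
- by move=> *; rewrite add0r.
- by move=> ?; rewrite scaleN1r addNr.
- by move=> *; rewrite mulrA.
- by move=> *; rewrite mul1r.
- by move=> *; rewrite mulr1.
- by move=> *; rewrite mulrDl.
- by move=> *; rewrite mulrDr.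
- by move=> *; rewrite scalerA.
- by move=> *; rewrite scale1r.
- by move=> *; rewrite scalerDr.
- by move=> *; rewrite scalerDl.
- by move=> *; rewrite scalerAl.
- by move=> *; rewrite scalerAr.
Qed.

Lemma presented_oner_neq0 (B : algType R) (g : I -> B) :
  (forall s t, S s t -> aeval g s = aeval g t) -> (1 : presented) != 0.
Proof.
move=> gS; apply/negP => /eqP /presentedP /(acongr_aeval gS) /= /eqP.
by rewrite oner_eq0.
Qed.

End PresentedAlgebra.

Section CommutativeClifford.
Variables (R : realType) (p q : nat).

(* 'I_n is 0-based: i : 'I_n stands for e_{i+1}, which squares to 1 if    *)
(* i < p, and to -1 otherwise.                                                *)
Definition Ksign (i : 'I_(p + q)) : R := if (i < p)%N then 1 else - 1.

Inductive Krel : aterm R 'I_(p + q) -> aterm R 'I_(p + q) -> Prop :=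
  | Krel_sqr i : Krel (AMul (AGen R i) (AGen R i)) (AScale (Ksign i) (AOne R _))
  | Krel_comm i j :
      Krel (AMul (AGen R i) (AGen R j)) (AMul (AGen R j) (AGen R i)).

Definition K := presented Krel.

HB.instance Definition _ := GRing.PzRing.on K.
HB.instance Definition _ := GRing.Lmodule.on K.

(* K_{p,q} acts on R^2, with e_i acting as the identity or as a rotation by a *)
(* right angle, hence it is not the zero ring.                                *)
Lemma K_oner_neq0 : (1 : K) != 0.
Proof.
pose J : 'M[R]_2 := \matrix_(i, j) if i == j then 0 else (-1) ^+ i.
have JJ : J * J = - 1.
  apply/matrixP => i j; rewrite !mxE !big_ord_recl big_ord0 !mxE.
  by case: i => [[|[|//]] ?]; case: j => [[|[|//]] ?];
    rewrite !(mul0r, mulr0, add0r, addr0, oppr0, mul1r, mulr1).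
pose g (i : 'I_(p + q)) : 'M[R]_2 := if (i < p)%N then 1 else J.
apply: (@presented_oner_neq0 R _ Krel _ g) => s t [i|i j] /=.
  by rewrite /g /Ksign; case: ifP => _; rewrite ?mulr1 ?scale1r// JJ scaleN1r.
by rewrite /g; case: ifP => _; case: ifP => _; rewrite ?mulr1 ?mul1r.
Qed.

HB.instance Definition _ := GRing.PzSemiRing_isNonZero.Build K K_oner_neq0.
HB.instance Definition _ := GRing.Lmodule_isLalgebra.Build R K (@pscaleAl R _ Krel).
HB.instance Definition _ := GRing.Lalgebra_isAlgebra.Build R K (@pscaleAr R _ Krel).

Definition Kgen (i : 'I_(p + q)) : K := pgen Krel i.

Lemma Kgen_sqr i : Kgen i * Kgen i = Ksign i *: 1.
Proof.
rewrite [LHS](pi_mul Krel) [RHS](pi_scale Krel).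
by apply/presentedP; apply: acongr_rel; apply: Krel_sqr.
Qed.

Lemma Kgen_comm i j : Kgen i * Kgen j = Kgen j * Kgen i.
Proof.
rewrite [LHS](pi_mul Krel) [RHS](pi_mul Krel).
by apply/presentedP; apply: acongr_rel; apply: Krel_comm.
Qed.

Lemma K_ind (P : K -> Prop) :
    (forall i, P (Kgen i)) -> P 0 -> P 1 ->
    (forall x y, P x -> P y -> P (x + y)) ->
    (forall x y, P x -> P y -> P (x * y)) ->
    (forall c x, P x -> P (c *: x)) ->
  forall x, P x.
Proof.
move=> Pg P0 P1 PD PM PZ; elim/quotW; elim=> //.
- by move=> s Ps t Pt; rewrite -(pi_add Krel); apply: PD.
- by move=> s Ps t Pt; rewrite -(pi_mul Krel); apply: PM.
- by move=> c t Pt; rewrite -(pi_scale Krel); apply: PZ.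
Qed.

Lemma K_univ (B : algType R) (g : 'I_(p + q) -> B) :
    (forall i, g i * g i = Ksign i *: 1) ->
    (forall i j, g i * g j = g j * g i) ->
  exists f : {lrmorphism K -> B}, forall i, f (Kgen i) = g i.
Proof.
move=> g2 gC; pose f (x : K) := aeval g (repr x).
have fE t : f (\pi_(presented Krel) t) = aeval g t.
  by apply: (acongr_aeval _ (acongr_repr Krel t)) => _ _ [i|i j] /=.
have fD : nmod_morphism f.
  split; first exact: fE.
  by elim/quotW=> s; elim/quotW=> t; rewrite [_ + _](pi_add Krel) !fE.
have fM : monoid_morphism f.
  split; first exact: fE.
  by elim/quotW=> s; elim/quotW=> t; rewrite [_ * _](pi_mul Krel) !fE.
have fZ : scalable f.
  by move=> c; elim/quotW=> t; rewrite [_ *: _](pi_scale Krel) !fE.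
pose F : {lrmorphism K -> B} := HB.pack f
  (GRing.isNmodMorphism.Build _ _ f fD) (GRing.isMonoidMorphism.Build _ _ f fM)
  (GRing.isScalable.Build _ _ _ _ f fZ).
by exists F => i; apply: fE.
Qed.

End CommutativeClifford.

(* Needed for 1 != 0 in a tensor product of nonzero algebras, as an algType   *)
(* must be a nonzero ring.                                                    *)
Section LinearForm.
Variables (R : fieldType) (V : lmodType R) (v0 : V).
Local Open Scope classical_set_scope.

Lemma linear_form_exists : v0 != 0 -> exists f : {linear V -> R^o}, f v0 = 1.
Proof.
move=> v0_neq0.
pose P (W : set V) := [/\ forall c x y, W x -> W y -> W (c *: x + y) & ~ W v0].
have [|W [[Wlin Wv0] Wmax]] := @Zorn_bigcup V (fun W => P W).
  move=> F FP totF; split=> [c x y [X FX Xx] [Y FY Yy]|[X /FP[]//]].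
  have [XY|YX] := totF _ _ FX FY.
    by exists Y => //; have [+ _] := FP _ FY; apply=> //; apply: XY.
  by exists X => //; have [+ _] := FP _ FX; apply=> //; apply: YX.
have W0 : W 0.
  apply: contrapT => W0; apply: (Wmax (W `|` [set 0])).
    by split=> [x Wx|WW]; [left | apply/W0/WW; right].
  split=> [c x y|[//|/eqP]]; last exact/negP.
  move=> [Wx|->] [Wy|->]; rewrite ?scaler0 ?addr0 ?add0r.
  - by left; apply: Wlin.
  - left; have := Wlin (c - 1) x x Wx Wx.
    by rewrite scalerBl scale1r subrK.
  - by left.
  - by right.
have WD x y : W x -> W y -> W (x + y).
  by move=> /(Wlin 1) /[apply]; rewrite scale1r.
have WZ c x : W x -> W (c *: x).
  by move=> Wx; have := Wlin c x 0 Wx W0; rewrite addr0.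
have dec x : exists c, W (x - c *: v0).
  have [Wx|Wx] := pselect (W x); first by exists 0; rewrite scale0r subr0.
  pose W' := [set y | exists w d, W w /\ y = w + d *: x].
  have WW' : W `<` W'.
    split=> [w Ww|WW]; first by exists w, 0; rewrite scale0r addr0.
    by apply/Wx/WW; exists 0, 1; rewrite scale1r add0r.
  have [w [d [Ww v0E]]] : W' v0.
    apply: contrapT => W'v0; apply: (Wmax _ WW'); split=> // c y z.
    move=> [w [d [Ww ->]]] [w' [d' [Ww' ->]]].
    exists (c *: w + w'), (c * d + d'); split; first exact: Wlin.
    by rewrite scalerDr scalerA scalerDl addrACA.
  have d0 : d != 0.
    by apply/eqP => d0; apply: Wv0; rewrite v0E d0 scale0r addr0.
  exists d^-1; rewrite v0E scalerDr scalerA mulVf// scale1r opprD addrCA subrr.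
  by rewrite addr0 -scaleN1r; do 2!apply: (WZ).
have [f fP] := choice dec.
have funiq x c : W (x - c *: v0) -> f x = c.
  move=> Wc; apply/eqP; rewrite -subr_eq0; apply/negP => /negP fc0; apply: Wv0.
  have := WZ (f x - c)^-1 _ (WD _ _ Wc (WZ (-1) _ (fP x))).
  rewrite scaleN1r opprB [X in W (_ *: X)]addrC addrA subrK -scalerBl.
  by rewrite scalerA mulVf// scale1r.
have flin : linear (f : V -> R^o).
  move=> c x y; apply: funiq; have := Wlin c _ _ (fP x) (fP y).
  by rewrite scalerBr scalerA addrACA -opprD -scalerDl.
pose F : {linear V -> R^o} := HB.pack f (GRing.isLinear.Build _ _ _ _ f flin).
by exists F; apply: funiq; rewrite scale1r subrr.
Qed.

End LinearForm.

Section TensorProduct.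
Variables (R : fieldType) (I : finType) (A : I -> algType R).

Definition multilinear (V : lmodType R) (phi : (forall i, A i) -> V) :=
  (forall a i (x y : A i), phi (eqtype.dfwith a (x + y)) =
     phi (eqtype.dfwith a x) + phi (eqtype.dfwith a y)) /\
  (forall a i c (x : A i), phi (eqtype.dfwith a (c *: x)) =
     c *: phi (eqtype.dfwith a x)).

Inductive tterm : Type :=
  | TPure of forall i, A i
  | TZero
  | TAdd of tterm & tterm
  | TScale of R & tterm.

HB.instance Definition _ := gen_eqMixin tterm.
HB.instance Definition _ := gen_choiceMixin tterm.

(* dfwith a x is the family a with its i-th entry replaced by x : A i. *)
Inductive tcongr : tterm -> tterm -> Prop :=
  | tcongr_pureD a i (x y : A i) :
      tcongr (TPure (eqtype.dfwith a (x + y)))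
        (TAdd (TPure (eqtype.dfwith a x)) (TPure (eqtype.dfwith a y)))
  | tcongr_pureZ a i c (x : A i) :
      tcongr (TPure (eqtype.dfwith a (c *: x)))
        (TScale c (TPure (eqtype.dfwith a x)))
  | tcongr_refl t : tcongr t t
  | tcongr_sym s t : tcongr s t -> tcongr t s
  | tcongr_trans s t u : tcongr s t -> tcongr t u -> tcongr s u
  | tcongrD s s' t t' : tcongr s s' -> tcongr t t' ->
      tcongr (TAdd s t) (TAdd s' t')
  | tcongrZ c t t' : tcongr t t' -> tcongr (TScale c t) (TScale c t')
  | tcongr_addA s t u : tcongr (TAdd s (TAdd t u)) (TAdd (TAdd s t) u)
  | tcongr_addC s t : tcongr (TAdd s t) (TAdd t s)
  | tcongr_add0 t : tcongr (TAdd TZero t) t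
  | tcongr_addN t : tcongr (TAdd (TScale (- 1) t) t) TZero
  | tcongr_scaleA c d t : tcongr (TScale c (TScale d t)) (TScale (c * d) t)
  | tcongr_scale1 t : tcongr (TScale 1 t) t
  | tcongr_scaleDr c s t :
      tcongr (TScale c (TAdd s t)) (TAdd (TScale c s) (TScale c t))
  | tcongr_scaleDl c d t :
      tcongr (TScale (c + d) t) (TAdd (TScale c t) (TScale d t)).

Definition tcongrb : rel tterm := fun s t => `[< tcongr s t >].

Lemma tcongrb_refl : reflexive tcongrb.
Proof. by move=> t; apply/asboolP; apply: tcongr_refl. Qed.

Lemma tcongrb_sym : symmetric tcongrb.
Proof. by move=> s t; apply/asboolP/asboolP => /tcongr_sym. Qed.

Lemma tcongrb_trans : transitive tcongrb.
Proof.
move=> t s u /asboolP st /asboolP tu; apply/asboolP; exact: tcongr_trans st tu.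
Qed.

Canonical tcongr_equiv := EquivRel tcongrb tcongrb_refl tcongrb_sym tcongrb_trans.

Definition tensor := {eq_quot tcongr_equiv}.

HB.instance Definition _ := EqQuotient.on tensor.
HB.instance Definition _ := Choice.on tensor.

Lemma tensorP s t : \pi_tensor s = \pi_tensor t <-> tcongr s t.
Proof. by split=> [/eqmodP/asboolP|st]; [|apply/eqmodP/asboolP]. Qed.

Lemma tcongr_repr t : tcongr (repr (\pi_tensor t)) t.
Proof. by apply/tensorP; rewrite reprK. Qed.

Definition pure (a : forall i, A i) : tensor := \pi_tensor (TPure a).
Definition tzero : tensor := \pi_tensor TZero.
Definition tadd (x y : tensor) : tensor := \pi_tensor (TAdd (repr x) (repr y)).
Definition tscale c (x : tensor) : tensor := \pi_tensor (TScale c (repr x)).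
Definition topp (x : tensor) : tensor := tscale (- 1) x.

Lemma tpi_add s t : tadd (\pi_tensor s) (\pi_tensor t) = \pi_tensor (TAdd s t).
Proof. by apply/tensorP; apply: tcongrD; apply: tcongr_repr. Qed.

Lemma tpi_scale c t : tscale c (\pi_tensor t) = \pi_tensor (TScale c t).
Proof. by apply/tensorP; apply: tcongrZ; apply: tcongr_repr. Qed.

Lemma taddA : associative tadd.
Proof.
by elim/quotW=> s; elim/quotW=> t; elim/quotW=> u;
  rewrite (tpi_add t u) (tpi_add s t) !tpi_add; apply/tensorP; constructor.
Qed.

Lemma taddC : commutative tadd.
Proof.
by elim/quotW=> s; elim/quotW=> t; rewrite !tpi_add; apply/tensorP; constructor.
Qed.

Lemma tadd0 : left_id tzero tadd.
Proof. by elim/quotW=> t; rewrite tpi_add; apply/tensorP; constructor. Qed.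

Lemma taddN : left_inverse tzero topp tadd.
Proof.
by elim/quotW=> t; rewrite /topp tpi_scale tpi_add; apply/tensorP; constructor.
Qed.

HB.instance Definition _ := GRing.isZmodule.Build tensor taddA taddC tadd0 taddN.

Lemma tscaleA c d x : tscale c (tscale d x) = tscale (c * d) x.
Proof.
elim/quotW: x => t; rewrite (tpi_scale d t) !tpi_scale.
by apply/tensorP; constructor.
Qed.

Lemma tscale1 : left_id 1 tscale.
Proof. by elim/quotW=> t; rewrite tpi_scale; apply/tensorP; constructor. Qed.

Lemma tscaleDr : right_distributive tscale tadd.
Proof.
move=> c; elim/quotW=> s; elim/quotW=> t.
rewrite (tpi_add s t) (tpi_scale c s) (tpi_scale c t) tpi_add tpi_scale.
by apply/tensorP; constructor.
Qed.

Lemma tscaleDl x : {morph tscale^~ x : c d / c + d >-> tadd c d}.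
Proof.
move=> c d; elim/quotW: x => t; rewrite !tpi_scale tpi_add.
by apply/tensorP; constructor.
Qed.

HB.instance Definition _ :=
  GRing.Zmodule_isLmodule.Build R tensor tscaleA tscale1 tscaleDr tscaleDl.

Lemma pure_multilinear : multilinear pure.
Proof.
split=> [a i x y|a i c x].
  by rewrite [RHS]tpi_add; apply/tensorP; constructor.
by rewrite [RHS]tpi_scale; apply/tensorP; constructor.
Qed.

Lemma tensor_ind (P : tensor -> Prop) :
    (forall a, P (pure a)) -> P 0 -> (forall x y, P x -> P y -> P (x + y)) ->
    (forall c x, P x -> P (c *: x)) ->
  forall x, P x.
Proof.
move=> Pp P0 PD PZ; elim/quotW; elim=> //.
- by move=> s Ps t Pt; rewrite -tpi_add; apply: PD.
- by move=> c t Pt; rewrite -tpi_scale; apply: PZ.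
Qed.

Fixpoint teval (V : lmodType R) (phi : (forall i, A i) -> V) (t : tterm) : V :=
  match t with
  | TPure a => phi a
  | TZero => 0
  | TAdd s t => teval phi s + teval phi t
  | TScale c t => c *: teval phi t
  end.

Lemma tcongr_teval (V : lmodType R) (phi : (forall i, A i) -> V) :
  multilinear phi -> forall s t, tcongr s t -> teval phi s = teval phi t.
Proof.
move=> [phiD phiZ] s t; elim=> //=.
- by move=> ? ? ? _ -> _ ->.
- by move=> ? ? ? ? _ -> _ ->.
- by move=> ? ? ? _ ->.
- by move=> *; rewrite addrA.
- by move=> *; rewrite addrC.
- by move=> *; rewrite add0r.
- by move=> ?; rewrite scaleN1r addNr.
- by move=> *; rewrite scalerA.
- by move=> *; rewrite scale1r.
- by move=> *; rewrite scalerDr.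
- by move=> *; rewrite scalerDl.
Qed.

Definition tlift (V : lmodType R) (phi : (forall i, A i) -> V) (x : tensor) : V :=
  teval phi (repr x).

Section TLift.
Variables (V : lmodType R) (phi : (forall i, A i) -> V).
Hypothesis phi_lin : multilinear phi.

Lemma tlift_pi t : tlift phi (\pi_tensor t) = teval phi t.
Proof. exact/tcongr_teval/tcongr_repr. Qed.

Lemma tlift_pure a : tlift phi (pure a) = phi a.
Proof. exact: tlift_pi. Qed.

Lemma tlift0 : tlift phi 0 = 0.
Proof. exact: tlift_pi. Qed.

Lemma tliftD x y : tlift phi (x + y) = tlift phi x + tlift phi y.
Proof.
by elim/quotW: x => s; elim/quotW: y => t; rewrite [_ + _]tpi_add !tlift_pi.
Qed.

Lemma tliftZ c x : tlift phi (c *: x) = c *: tlift phi x.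
Proof. by elim/quotW: x => t; rewrite [_ *: _]tpi_scale !tlift_pi. Qed.

End TLift.

Definition tone : tensor := pure (fun=> 1).
Definition tmul (x y : tensor) : tensor :=
  tlift (fun a => tlift (fun b => pure (fun i => a i * b i)) y) x.

Lemma dfwith_mull (a b : forall i, A i) i (x : A i) :
  (fun j => eqtype.dfwith a x j * b j) =
  eqtype.dfwith (fun j => a j * b j) (x * b i).
Proof.
apply: functional_extensionality_dep => j.
have [<-|ij] := eqVneq i j; first by rewrite !eqtype.dfwith_in.
by rewrite !eqtype.dfwith_out.
Qed.

Lemma dfwith_mulr (a b : forall i, A i) i (y : A i) :
  (fun j => a j * eqtype.dfwith b y j) =
  eqtype.dfwith (fun j => a j * b j) (a i * y).
Proof.
apply: functional_extensionality_dep => j.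
have [<-|ij] := eqVneq i j; first by rewrite !eqtype.dfwith_in.
by rewrite !eqtype.dfwith_out.
Qed.

Lemma tmul_multilinearr a : multilinear (fun b => pure (fun i => a i * b i)).
Proof.
split=> [b i x y|b i c x]; rewrite !dfwith_mulr.
  by rewrite mulrDr (pure_multilinear.1).
by rewrite -scalerAr (pure_multilinear.2).
Qed.

Lemma tmul_multilinearl y :
  multilinear (fun a => tlift (fun b => pure (fun i => a i * b i)) y).
Proof.
split=> [a i u v|a i c u]; elim/tensor_ind: y => [b||y z IHy IHz|d y IHy];
    rewrite ?(tlift0 (tmul_multilinearr _)) ?(tliftD (tmul_multilinearr _))
      ?(tliftZ (tmul_multilinearr _)) ?(tlift_pure (tmul_multilinearr _)).
- by rewrite !dfwith_mull mulrDl (pure_multilinear.1).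
- by rewrite addr0.
- by rewrite IHy IHz addrACA.
- by rewrite IHy scalerDr.
- by rewrite !dfwith_mull -scalerAl (pure_multilinear.2).
- by rewrite scaler0.
- by rewrite IHy IHz scalerDr.
- by rewrite IHy !scalerA mulrC.
Qed.

Lemma tmul_pure a b : tmul (pure a) (pure b) = pure (fun i => a i * b i).
Proof.
by rewrite /tmul (tlift_pure (tmul_multilinearl _)) (tlift_pure (tmul_multilinearr _)).
Qed.

Lemma tmul0l x : tmul 0 x = 0.
Proof. exact: tlift0 (tmul_multilinearl _). Qed.

Lemma tmulDl : left_distributive tmul +%R.
Proof. by move=> x y z; apply: tliftD (tmul_multilinearl _) _ _. Qed.

Lemma tmulZl c x y : tmul (c *: x) y = c *: tmul x y.
Proof. exact: tliftZ (tmul_multilinearl _) _ _. Qed.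

Lemma tmulDr : right_distributive tmul +%R.
Proof.
move=> x y z; elim/tensor_ind: x => [a||x x' IHx IHx'|c x IHx].
- rewrite /tmul !(tlift_pure (tmul_multilinearl _)).
  exact: tliftD (tmul_multilinearr _) _ _.
- by rewrite !tmul0l addr0.
- by rewrite !tmulDl IHx IHx' addrACA.
- by rewrite !tmulZl IHx scalerDr.
Qed.

Lemma tmulZr c x y : tmul x (c *: y) = c *: tmul x y.
Proof.
elim/tensor_ind: x => [a||x x' IHx IHx'|d x IHx].
- rewrite /tmul !(tlift_pure (tmul_multilinearl _)).
  exact: tliftZ (tmul_multilinearr _) _ _.
- by rewrite !tmul0l scaler0.
- by rewrite !tmulDl IHx IHx' scalerDr.
- by rewrite !tmulZl IHx !scalerA mulrC.
Qed.

Lemma tmul0r x : tmul x 0 = 0.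
Proof. by have := tmulZr 0 x 0; rewrite !scale0r. Qed.

Lemma tmulA : associative tmul.
Proof.
move=> x y z.
elim/tensor_ind: x => [a||x x' IHx IHx'|c x IHx]; last 3 first.
- by rewrite !tmul0l.
- by rewrite !tmulDl IHx IHx'.
- by rewrite !tmulZl IHx.
elim/tensor_ind: y => [b||y y' IHy IHy'|c y IHy]; last 3 first.
- by rewrite tmul0l !tmul0r tmul0l.
- by rewrite tmulDl !tmulDr tmulDl IHy IHy'.
- by rewrite tmulZl !tmulZr tmulZl IHy.
elim/tensor_ind: z => [d||z z' IHz IHz'|c z IHz]; last 3 first.
- by rewrite !tmul0r.
- by rewrite !tmulDr IHz IHz'.
- by rewrite !tmulZr IHz.
rewrite !tmul_pure; congr pure; apply: functional_extensionality_dep => i.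
exact: mulrA.
Qed.

Lemma tmul1l : left_id tone tmul.
Proof.
elim/tensor_ind=> [a||x y IHx IHy|c x IHx].
- rewrite tmul_pure; congr pure; apply: functional_extensionality_dep => i.
  exact: mul1r.
- exact: tmul0r.
- by rewrite tmulDr IHx IHy.
- by rewrite tmulZr IHx.
Qed.

Lemma tmul1r : right_id tone tmul.
Proof.
elim/tensor_ind=> [a||x y IHx IHy|c x IHx].
- rewrite tmul_pure; congr pure; apply: functional_extensionality_dep => i.
  exact: mulr1.
- exact: tmul0l.
- by rewrite tmulDl IHx IHy.
- by rewrite tmulZl IHx.
Qed.

Lemma tone_neq0 : tone != 0.
Proof.
have [f fP] : exists f : forall i, {linear A i -> R^o}, forall i, f i 1 = 1.
  have ex i : exists f : {linear A i -> R^o}, f 1 = 1.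
    exact/linear_form_exists/oner_neq0.
  by exists (fun i => sval (cid (ex i))) => i; exact: (svalP (cid (ex i))).
pose phi (a : forall i, A i) : R^o := \prod_i f i (a i).
have phiE a i (x : A i) :
    phi (eqtype.dfwith a x) = f i x * \prod_(j | j != i) f j (a j).
  rewrite /phi (bigD1 i)//= eqtype.dfwith_in; congr (_ * _).
  by apply: eq_bigr => j ji; rewrite eqtype.dfwith_out// eq_sym.
have phi_lin : multilinear phi.
  split=> [a i x y|a i c x]; rewrite !phiE; first by rewrite raddfD mulrDl.
  by rewrite linearZ /= -mulrA.
apply/negP => /eqP /(congr1 (tlift phi)).
rewrite (tlift0 phi_lin) (tlift_pure phi_lin) /phi big1// => /eqP.
by rewrite oner_eq0.
Qed.

HB.instance Definition _ := GRing.Zmodule_isNzRing.Build tensor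
  tmulA tmul1l tmul1r tmulDl tmulDr tone_neq0.
HB.instance Definition _ := GRing.Lmodule_isLalgebra.Build R tensor
  (fun c x y => esym (tmulZl c x y)).
HB.instance Definition _ := GRing.Lalgebra_isAlgebra.Build R tensor
  (fun c x y => esym (tmulZr c x y)).

Lemma pureM a b : pure a * pure b = pure (fun i => a i * b i).
Proof. exact: tmul_pure. Qed.

End TensorProduct.

(* Main.v *)
Require Import Defs.
From mathcomp Require Import all_boot all_order all_algebra reals.
From HB Require Import structures.
From mathcomp Require Import boolp.
Local Open Scope ring_scope.

(** Both sides have the same universal property.  An algebra map out of
    [K R p q] is a choice of pairwise commuting elements with the prescribed
    squares.  On the other side, a tensor product of algebras receives each
    factor through the canonical embedding [tensor_in i], the images of distinct
    factors commute ([tensor_in_comm]) and generate ([pure_prod]), and for a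
    commutative target the tensor product is the coproduct ([tensor_univ],
    [tensor_morph_ext]); since each factor has a single generator of square 1 or
    -1, an algebra map from the tensor product to a commutative algebra is again
    a choice of elements with the prescribed squares.

    Hence sending e_i to the generator of the i-th factor defines an algebra map
    from [K R p q] to the tensor product, and, as [K R p q] is commutative
    ([K_mulC]), sending the generator of the i-th factor to e_i defines a map
    back.  The two composites fix all generators, so they are identities. *)

Import GRing.Theory.
Set Implicit Arguments.
Unset Strict Implicit.
Unset Printing Implicit Defensive.

(** * Tensor products as coproducts *)

Section TensorCoproduct.
Variables (R : fieldType) (I : finType) (A : I -> algType R).

Definition tensor_in i (x : A i) : tensor A :=
  pure (eqtype.dfwith (fun j => 1 : A j) x).

Lemma dfwith_self (a : forall i, A i) i : eqtype.dfwith a (a i) = a.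
Proof.
apply: functional_extensionality_dep => j.
have [<-|ij] := eqVneq i j; first by rewrite eqtype.dfwith_in.
by rewrite eqtype.dfwith_out.
Qed.

Lemma tensor_in_is_nmod_morphism i : nmod_morphism (@tensor_in i).
Proof.
split=> [|x y]; last exact: (pure_multilinear A).1.
by rewrite -[X in tensor_in X](scale0r 0) [LHS](pure_multilinear A).2 scale0r.
Qed.

Lemma tensor_in_is_monoid_morphism i : monoid_morphism (@tensor_in i).
Proof.
split=> [|x y].
  by rewrite /tensor_in (dfwith_self (fun j => 1 : A j)).
rewrite [RHS]pureM dfwith_mull eqtype.dfwith_in; congr pure.
apply: functional_extensionality_dep => j.
have [<-|ij] := eqVneq i j; first by rewrite !eqtype.dfwith_in.
by rewrite !eqtype.dfwith_out// mul1r.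
Qed.

Lemma tensor_in_is_scalable i : scalable (@tensor_in i).
Proof. by move=> c x; apply: (pure_multilinear A).2. Qed.

HB.instance Definition _ i := GRing.isNmodMorphism.Build _ _ (@tensor_in i)
  (@tensor_in_is_nmod_morphism i).
HB.instance Definition _ i := GRing.isMonoidMorphism.Build _ _ (@tensor_in i)
  (@tensor_in_is_monoid_morphism i).
HB.instance Definition _ i := GRing.isScalable.Build _ _ _ _ (@tensor_in i)
  (@tensor_in_is_scalable i).

Lemma tensor_in_comm i j (x : A i) (y : A j) :
  i != j -> tensor_in x * tensor_in y = tensor_in y * tensor_in x.
Proof.
move=> ij; rewrite !pureM; congr pure; apply: functional_extensionality_dep => k.
have [<-|ik] := eqVneq i k.
  by rewrite eqtype.dfwith_in eqtype.dfwith_out 1?eq_sym// mulr1 mul1r.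
by rewrite (eqtype.dfwith_out _ _ ik) mulr1 mul1r.
Qed.

(** The embedded factors generate the tensor product, whether or not it is
    commutative: the product runs over the fixed enumeration of [I], and each
    slot of a pure tensor is filled by exactly one of its terms. *)
Lemma pure_prod (a : forall i, A i) : pure a = \prod_i tensor_in (a i).
Proof.
have prodE (s : seq I) : uniq s ->
    \prod_(i <- s) tensor_in (a i) = pure (fun i => if i \in s then a i else 1).
  elim: s => [|i s IHs] /= => [_|/andP[iNs us]]; first by rewrite big_nil.
  rewrite big_cons IHs// pureM; congr pure.
  apply: functional_extensionality_dep => j; rewrite inE eq_sym.
  have [<-|ij] := eqVneq i j.
    by rewrite eqtype.dfwith_in (negbTE iNs) mulr1.
  by rewrite eqtype.dfwith_out// mul1r.
rewrite prodE ?index_enum_uniq//; congr pure.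
by apply: functional_extensionality_dep => i; rewrite mem_index_enum.
Qed.

Lemma tensor_morph_ext (B : algType R) (f g : {lrmorphism tensor A -> B}) :
  (forall i (x : A i), f (tensor_in x) = g (tensor_in x)) -> f =1 g.
Proof.
move=> fg; elim/tensor_ind=> [a||x y fgx fgy|c x fgx].
- by rewrite pure_prod !rmorph_prod; apply: eq_bigr => i _; apply: fg.
- by rewrite !rmorph0.
- by rewrite !rmorphD /= fgx fgy.
- by rewrite !linearZ /= fgx.
Qed.

(** Commutativity of [B] is what makes the multilinear map
    a |-> \prod_i h i (a i) multiplicative. *)
Lemma tensor_univ (B : comAlgType R) (h : forall i, {lrmorphism A i -> B}) :
  exists f : {lrmorphism tensor A -> B},
    forall i (x : A i), f (tensor_in x) = h i x.
Proof.
pose phi (a : forall i, A i) : B := \prod_i h i (a i).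
have phiE a i (x : A i) :
    phi (eqtype.dfwith a x) = h i x * \prod_(j | j != i) h j (a j).
  rewrite /phi (bigD1 i)//= eqtype.dfwith_in; congr (_ * _).
  by apply: eq_bigr => j ji; rewrite eqtype.dfwith_out// eq_sym.
have phi_lin : multilinear phi.
  split=> [a i x y|a i c x]; rewrite !phiE; first by rewrite rmorphD mulrDl.
  by rewrite linearZ /= -scalerAl.
pose f : tensor A -> B := tlift phi.
have fpure a : f (pure a) = phi a by apply: tlift_pure.
have f0 : f 0 = 0 by apply: tlift0.
have fD x y : f (x + y) = f x + f y by apply: tliftD.
have fZ c x : f (c *: x) = c *: f x by apply: tliftZ.
have f1 : f 1 = 1.
  by rewrite [LHS]fpure /phi big1// => i _; rewrite rmorph1.
have fM x y : f (x * y) = f x * f y.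
  elim/tensor_ind: x => [a||x x' IHx IHx'|c x IHx]; last 3 first.
  - by rewrite mul0r f0 mul0r.
  - by rewrite mulrDl !fD IHx IHx' mulrDl.
  - by rewrite -scalerAl !fZ IHx scalerAl.
  elim/tensor_ind: y => [b||y y' IHy IHy'|c y IHy]; last 3 first.
  - by rewrite mulr0 f0 mulr0.
  - by rewrite mulrDr !fD IHy IHy' mulrDr.
  - by rewrite -scalerAr !fZ IHy scalerAr.
  rewrite pureM !fpure /phi -big_split.
  by apply: eq_bigr => i _; rewrite rmorphM.
pose F : {lrmorphism tensor A -> B} := HB.pack f
  (GRing.isNmodMorphism.Build _ _ f (conj f0 fD))
  (GRing.isMonoidMorphism.Build _ _ f (conj f1 fM))
  (GRing.isScalable.Build _ _ _ _ f fZ).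
exists F => i x; rewrite [LHS]fpure phiE big1 ?mulr1// => j _.
exact: rmorph1.
Qed.

End TensorCoproduct.

(** * The algebras K_{p,q} *)

Section CliffordAnalogue.
Variables (R : realType) (p q : nat).

Lemma K_morph_ext (B : algType R) (f g : {lrmorphism K R p q -> B}) :
  (forall i, f (Kgen R i) = g (Kgen R i)) -> f =1 g.
Proof.
move=> fg; elim/K_ind=> [//|||x y fgx fgy|x y fgx fgy|c x fgx].
- by rewrite !rmorph0.
- by rewrite !rmorph1.
- by rewrite !rmorphD /= fgx fgy.
- by rewrite !rmorphM /= fgx fgy.
- by rewrite !linearZ /= fgx.
Qed.

(** The centralizer of any element is a subalgebra, so commutation spreads from
    the generators to one argument, then to the other. *)
Lemma K_mulC : commutative (@GRing.mul (K R p q)).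
Proof.
have spread (x : K R p q) : (forall i, GRing.comm x (Kgen R i)) ->
    forall y, GRing.comm x y.
  move=> xg; elim/K_ind=> [//|||y z|y z|c y xy].
  - exact: commr0.
  - exact: commr1.
  - exact: commrD.
  - exact: commrM.
  - by rewrite /GRing.comm -scalerAr xy scalerAl.
move=> x y; apply: (spread) => i.
by apply/commr_sym/spread => j; apply: Kgen_comm.
Qed.

HB.instance Definition _ := GRing.PzRing_hasCommutativeMul.Build (K R p q) K_mulC.

End CliffordAnalogue.

(** * The factors K_{1,0} and K_{0,1} *)

Section Factors.
Variable R : realType.

(** Indexing the two one-generator algebras by a boolean confines the case
    analysis on the position of a factor to the lemmas of this section. *)
Definition K1 (b : bool) : algType R :=
  if b then K R 1 0 : algType R else K R 0 1.

Definition K1gen (b : bool) : K1 b :=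
  if b as b0 return K1 b0 then @Kgen R 1 0 ord0
  else @Kgen R 0 1 ord0.

Definition K1sign (b : bool) : R := if b then 1 else - 1.

Lemma K1gen_sqr b : K1gen b * K1gen b = K1sign b *: 1.
Proof. by case: b; exact: Kgen_sqr. Qed.

Lemma K1_univ b (B : algType R) (x : B) : x * x = K1sign b *: 1 ->
  exists f : {lrmorphism K1 b -> B}, f (K1gen b) = x.
Proof.
case: b => x2.
  have [//|//|f fE] := @K_univ R 1 0 B (fun=> x).
    by case=> [[]].
  by exists f; apply: fE.
have [//|//|f fE] := @K_univ R 0 1 B (fun=> x).
by exists f; apply: fE.
Qed.

Lemma K1_morph_ext b (B : algType R) (f g : {lrmorphism K1 b -> B}) :
  f (K1gen b) = g (K1gen b) -> f =1 g.
Proof.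
by case: b f g => f g fg; apply: K_morph_ext => i; rewrite (ord1 i).
Qed.

End Factors.

(** * The isomorphism *)

Theorem theorem3p1 (R : realType) (p q : nat) :
  exists f : {lrmorphism K R p q ->
      tensor (fun i : 'I_(p + q) =>
                if (i < p)%N then K R 1 0 : algType R else K R 0 1)},
    bijective f.
Proof.
pose A (i : 'I_(p + q)) : algType R := K1 R (i < p)%N.
pose e (i : 'I_(p + q)) : tensor A := tensor_in (K1gen R (i < p)%N : A i).
have e2 i : e i * e i = Ksign R i *: 1.
  rewrite /e -rmorphM K1gen_sqr -[1 in RHS](rmorph1 (@tensor_in _ _ A i)).
  exact: tensor_in_is_scalable.
have eC i j : e i * e j = e j * e i.
  by have [->//|ij] := eqVneq i j; apply: tensor_in_comm.
have [f fE] := K_univ e2 eC.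
have hP i : exists h : {lrmorphism A i -> K R p q}, h (K1gen R (i < p)%N) = Kgen R i.
  by apply: K1_univ; apply: Kgen_sqr.
pose h i := sval (cid (hP i)).
have hE i : h i (K1gen R (i < p)%N) = Kgen R i by apply: svalP (cid (hP i)).
have [g gE] := tensor_univ h.
exists f; exists g.
- apply: (K_morph_ext (f := g \o f) (g := idfun)) => i /=.
  by rewrite fE gE hE.
- apply: (tensor_morph_ext (f := f \o g) (g := idfun)) => i.
  pose inA : {lrmorphism A i -> tensor A} := @tensor_in _ _ A i.
  apply: (K1_morph_ext (f := f \o g \o inA) (g := inA)) => /=.
  by rewrite gE hE fE.
Qed.
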